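(* Let $G=(V,E)$ be a finite undirected graph, let $s,t$ be distinct non-adjacent nodes with $st$ node connectivity $k^{st}$, and let a palette of $n_c$ colors be available. Color $G$ by the Path-based Color Assignment: choose $k^{st}$ pairwise internally node-disjoint $s$–$t$ paths; give all nodes of each path (other than $s,t$) one common color, using pairwise distinct colors for the paths if $n_c\ge k^{st}$, and otherwise using distinct colors for $n_c$ of the paths and arbitrary colors for the remaining paths; all other nodes (including $s,t$) receive arbitrary colors. Then the value of the minimum color $st$ node cut of the resulting colored graph is $\min(k^{st},n_c)$.
   Context: The $st$ node connectivity $k^{st}$ is the minimum size of an $st$ node cut, i.e. of a set $X\subseteq V\setminus\{s,t\}$ whose removal leaves $s$ and $t$ in different connected components. In a colored graph (each node carries one color), a color $st$ node cut is a set $C_c$ of colors such that the set of nodes whose colors lie in $C_c$ (possibly including $s$ or $t$) contains an $st$ node cut; the value of the minimum color $st$ node cut is the minimum size of such a $C_c$. *)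

(* Defs.v *)
From mathcomp Require Import all_boot.
Set Implicit Arguments.
Unset Strict Implicit.
Unset Printing Implicit Defensive.

Definition is_min_card (T : finType) (P : pred {set T}) (m : nat) : Prop :=
  (exists2 X : {set T}, P X & #|X| = m) /\
  (forall X : {set T}, P X -> m <= #|X|).

Section Graph.

(* The graph G = (V, E) is given by its adjacency relation [e], assumed
   symmetric in the statement; loops are not excluded. *)
Variables (V : finType) (e : rel V) (s t : V).

Definition del_nodes (X : {set V}) : rel V :=
  [rel x y | [&& e x y, x \notin X & y \notin X]].

Definition node_cut (X : {set V}) : bool :=
  [&& s \notin X, t \notin X & ~~ connect (del_nodes X) s t].

Definition node_connectivity (k : nat) : Prop := is_min_card node_cut k.

(* An s-t path is represented by the sequence [p] of its internal nodes. *)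
Definition st_path (p : seq V) : bool :=
  path e s (rcons p t) && uniq (s :: rcons p t).

Section Coloring.

Variables (nc : nat) (col : V -> 'I_nc).

Definition color_node_cut (C : {set 'I_nc}) : bool :=
  [exists X : {set V}, (X \subset col @^-1: C) && node_cut X].

Definition min_color_node_cut_value (m : nat) : Prop :=
  is_min_card color_node_cut m.

(* [col] is a possible outcome of the assignment: [P i] is the i-th of the [k]
   chosen paths and [c i] its color; [D] indexes the [nc] paths that receive
   distinct colors when the palette is too small. *)
Definition path_based_coloring (k : nat) : Prop :=
  exists (P : 'I_k -> seq V) (c : 'I_k -> 'I_nc),
    [/\ forall i, st_path (P i),
        forall i j, i != j -> ~~ has (mem (P i)) (P j),
        forall i x, x \in P i -> col x = c i
      & if k <= nc then injective c
        else exists2 D : {set 'I_k}, #|D| = nc & {in D &, injective c}].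

End Coloring.

End Graph.

(* Main.v *)
Require Import Defs.
From mathcomp Require Import all_boot.

Set Implicit Arguments.
Unset Strict Implicit.
Unset Printing Implicit Defensive.

(** A node cut meets every chosen path in an internal node, so a color cut
    contains the colors of all chosen paths, and these include [minn k nc]
    distinct ones. Conversely, the colors occurring on a minimum node cut form
    a color cut with at most [minn k nc] elements. *)

Lemma is_min_card_leq (T : finType) (P : pred {set T}) (m : nat) :
  (exists2 A : {set T}, P A & #|A| <= m) ->
  (forall A : {set T}, P A -> m <= #|A|) -> is_min_card P m.
Proof.
move=> [A PA leAm] lower; split=> //; exists A => //.
by apply/anti_leq; rewrite leAm lower.
Qed.

Section NodeCuts.

Variables (V : finType) (e : rel V) (s t : V).

Lemma node_cut_meets_path (X : {set V}) (p : seq V) :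
  node_cut e s t X -> path e s (rcons p t) -> has (mem X) p.
Proof.
move=> /and3P[sX tX cutX] ep; apply: contraNT cutX => pX.
have avoidX : all [predC X] (s :: rcons p t).
  by rewrite /= all_rcons /= sX tX all_predC.
apply/connectP; exists (rcons p t); last by rewrite last_rcons.
apply: sub_in_path avoidX ep => x y /= xX yX exy.
exact/and3P.
Qed.

Variables (nc : nat) (col : V -> 'I_nc).

Lemma color_node_cut_imset (X : {set V}) :
  node_cut e s t X -> color_node_cut e s t col (col @: X).
Proof.
by move=> cutX; apply/existsP; exists X; rewrite -sub_imset_pre subxx.
Qed.

Lemma exists_color_node_cut_leq (X : {set V}) :
  node_cut e s t X ->
  exists2 C : {set 'I_nc}, color_node_cut e s t col C & #|C| <= minn #|X| nc.
Proof.
move=> /color_node_cut_imset cutC; exists (col @: X) => //.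
by rewrite leq_min leq_imset_card -[leqRHS]card_ord max_card.
Qed.

Lemma color_node_cut_path_color (C : {set 'I_nc}) (p : seq V) (a : 'I_nc) :
  color_node_cut e s t col C -> path e s (rcons p t) ->
  {in p, forall x, col x = a} -> a \in C.
Proof.
move=> /existsP[X /andP[/subsetP XC cutX]] ep col_p.
have /hasP[x px Xx] := node_cut_meets_path cutX ep.
by rewrite -(col_p x px); have := XC x Xx; rewrite inE.
Qed.

Lemma path_colors_leq_color_node_cut (I : finType) (D : {set I})
    (P : I -> seq V) (c : I -> 'I_nc) (C : {set 'I_nc}) :
  {in D, forall i, path e s (rcons (P i) t)} ->
  {in D, forall i, {in P i, forall x, col x = c i}} ->
  {in D &, injective c} -> color_node_cut e s t col C -> #|D| <= #|C|.
Proof.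
move=> path_P col_P c_inj cutC; rewrite -(card_in_imset c_inj).
apply/subset_leq_card/subsetP => _ /imsetP[i Di ->].
exact: color_node_cut_path_color cutC (path_P i Di) (col_P i Di).
Qed.

Lemma path_based_coloring_leq_color_node_cut (k : nat) (C : {set 'I_nc}) :
  path_based_coloring e s t col k -> color_node_cut e s t col C ->
  minn k nc <= #|C|.
Proof.
move=> [P [c [st_P _ col_P c_distinct]]] cutC.
have [D <- c_inj] :
    exists2 D : {set 'I_k}, #|D| = minn k nc & {in D &, injective c}.
  case: leqP c_distinct => // _ c_inj.
  by exists setT; [rewrite cardsT card_ord | apply: in2W].
apply: path_colors_leq_color_node_cut c_inj cutC => i _; last exact: col_P i.
by have /andP[] := st_P i.
Qed.

End NodeCuts.

Theorem theorem5 (V : finType) (e : rel V) (e_sym : symmetric e)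
  (s t : V) (st_neq : s != t) (st_nadj : ~~ e s t)
  (k nc : nat) (conn_k : node_connectivity e s t k)
  (col : V -> 'I_nc) (col_P : path_based_coloring e s t col k) :
  min_color_node_cut_value e s t col (minn k nc).
Proof.
case: conn_k col_P => [[X cutX <-] _] col_P.
apply: is_min_card_leq => [|C]; first exact: exists_color_node_cut_leq.
exact: path_based_coloring_leq_color_node_cut.
Qed.
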